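(* Let $X\neq\varnothing$ be a finite set, let $\langle X\mid R\rangle$ be a presentation with balanced relators, and let $\varphi\colon\mathcal{O}\hookrightarrow U$ be a continuous open monomorphism of topological groups, where $\mathcal{O}$ is an open subgroup of $U$. Denote by $\iota\colon U\hookrightarrow\mathcal{H}_{\{t\}}(\varphi)$ the canonical embedding. Then the following hold: (1) There is a continuous group epimorphism $\overline{\psi}\colon G_\varphi\to\mathcal{H}_{\{t\}}(\varphi)$ such that $u\mapsto\iota(u)$ and $x\mapsto t$ for all $u\in U$, $x\in X$. (2) $\langle X\mid R\rangle$ can be generalised over $\varphi$. (3) For every $x\in X$ the map $\overline{\psi}$ has a right-inverse $j_x\colon\mathcal{H}_{\{t\}}(\varphi)\to G_\varphi$, which is a continuous open monomorphism satisfying $j_x|_U=\mathrm{id}_U$ and $j_x(t)=x$. (4) For every $x\in X$ the subgroup $j_x(\mathcal{H}_{\{t\}}(\varphi))$ is topologically isomorphic to $\mathcal{H}_{\{t\}}(\varphi)$ and is a group retract of $G_\varphi$.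
   Context: All topological groups are Hausdorff. A continuous open monomorphism is an injective group homomorphism that is continuous and open. For a finite set $X$, $\mathcal{H}_X(\varphi)=(U*F(X))/\langle\langle t\omega t^{-1}\varphi(\omega)^{-1}\mid t\in X,\omega\in\mathcal{O}\rangle\rangle$, endowed with the unique group topology making the canonical embedding $U\hookrightarrow\mathcal{H}_X(\varphi)$ continuous and open. For a presentation $\langle X\mid R\rangle$ with $X$ finite, $G_\varphi:=\mathcal{H}_X(\varphi)/\langle\langle R\rangle\rangle$, with the quotient topology; elements of $U$ and $X$ also denote their images in $G_\varphi$. The presentation can be generalised over $\varphi$ if the composite $U\hookrightarrow\mathcal{H}_X(\varphi)\twoheadrightarrow G_\varphi$ is injective. The presentation has balanced relators if every $r\in R$ lies in the kernel of the homomorphism $F(X)\to\mathbb{Z}$ sending each $x\in X$ to $1$. A group retract of a topological group $G$ is a closed subgroup $H\le G$ for which there is a continuous epimorphism $\rho\colon G\to H$ with $\rho|_H=\mathrm{id}_H$. *)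

(* Defs.v *)
From HB Require Import structures.
From mathcomp Require Import all_boot all_algebra all_classical.
From mathcomp Require Import topology.

Set Implicit Arguments.
Unset Strict Implicit.
Unset Printing Implicit Defensive.

Local Open Scope classical_set_scope.
Local Open Scope group_scope.
Local Open Scope quotient_scope.

(* Topological groups are not Hausdorff by definition here: the Hausdorff
   property of the base group is a separate hypothesis, since for a quotient
   such as [gen_group] below it has to be proved. *)
HB.mixin Record isTopologicalGroup G & Topological G & Group G := {
  mulg_continuous : continuous (fun z : G * G => z.1 * z.2);
  invg_continuous : continuous (fun x : G => x^-1)
}.

#[short(type="topGroupType")]
HB.structure Definition TopologicalGroup :=
  {G of Topological G & Group G & isTopologicalGroup G}.

Definition subgroup_set (G : groupType) (H : set G) : Prop :=
  [/\ H 1, (forall x y, H x -> H y -> H (x * y)) & (forall x, H x -> H x^-1)].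

Definition normal_subgroup_set (G : groupType) (H : set G) : Prop :=
  subgroup_set H /\ forall x g, H x -> H (g * x * g^-1).

Definition normal_closure (G : groupType) (S : set G) : set G :=
  smallest (@normal_subgroup_set G) S.

Definition group_hom (G H : groupType) (f : G -> H) : Prop :=
  {morph f : x y / x * y}.

Definition open_map (S T : topologicalType) (f : S -> T) : Prop :=
  forall W, open W -> open (f @` W).

Definition cont_open_mono (G H : topGroupType) (f : G -> H) : Prop :=
  [/\ group_hom f, injective f, continuous f & open_map f].

Definition cont_epi (G H : topGroupType) (f : G -> H) : Prop :=
  [/\ group_hom f, continuous f & set_surj setT setT f].

(* The subgroup K of G, with the subspace topology, is topologically isomorphic
   to H. *)
Definition top_isomorphic_subgroup (G H : topGroupType) (K : set G) : Prop :=
  exists (f : H -> G) (g : G -> H),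
    [/\ group_hom f, set_bij setT K f, cancel f g,
        continuous f & {within K, continuous g}].

(* [hausdorff_space G] is the standing convention on topological groups. A map
   onto K is continuous for the subspace topology of K iff it is continuous as a
   map into G. *)
Definition group_retract (G : topGroupType) (K : set G) : Prop :=
  [/\ hausdorff_space G, subgroup_set K, closed K &
      exists rho : G -> G,
        [/\ group_hom rho, continuous rho, set_surj setT K rho,
            (forall x, K (rho x)) & (forall x, K x -> rho x = x)]].

(* Only the restriction of [om_fun] to [om_dom] is relevant. Openness as a map
   on the open subgroup [om_dom] can be tested on the open sets of U contained
   in [om_dom]. *)
Record openMono (U : topGroupType) := OpenMono {
  om_dom : set U;
  om_fun :> U -> U;
  om_dom_subgroup : subgroup_set om_dom;
  om_dom_open : open om_dom;
  om_morph : {in om_dom &, {morph om_fun : x y / x * y}};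
  om_inj : {in om_dom &, injective om_fun};
  om_continuous : {within om_dom, continuous om_fun};
  om_open : forall W, W `<=` om_dom -> open W -> open (om_fun @` W)
}.

Section WordCongruence.
Variables (T : Type) (r : seq T -> seq T -> Prop).

Inductive wcong : seq T -> seq T -> Prop :=
| wcong_rel u v : r u v -> wcong u v
| wcong_refl u : wcong u u
| wcong_sym u v : wcong u v -> wcong v u
| wcong_trans u v w : wcong u v -> wcong v w -> wcong u w
| wcong_cat u u' v v' : wcong u u' -> wcong v v' -> wcong (u ++ v) (u' ++ v').

End WordCongruence.

Record wordPres (T : choiceType) := WordPres {
  wrel : seq T -> seq T -> Prop;
  winv : T -> T;
  winvr : forall a, wcong wrel [:: a; winv a] [::];
  winvl : forall a, wcong wrel [:: winv a; a] [::]
}.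

Section WordGroup.
Variables (T : choiceType) (P : wordPres T).
Implicit Types u v w : seq T.

Definition weq : rel (seq T) := fun u v => `[< wcong (wrel P) u v >].

Lemma weq_equiv : equiv_class_of weq.
Proof.
split=> [u|u v|v u w]; first by apply/asboolP; exact: wcong_refl.
- by apply/asboolP/asboolP; exact: wcong_sym.
- by move=> /asboolP uv /asboolP vw; apply/asboolP; exact: wcong_trans vw.
Qed.

Canonical weq_equiv_rel := EquivRelPack weq_equiv.

Definition word_group : Type := {eq_quot weq}.
HB.instance Definition _ := Choice.copy word_group {eq_quot weq}.

Definition word_class (w : seq T) : word_group := \pi_({eq_quot weq}) w.

Lemma word_classP u v : word_class u = word_class v <-> wcong (wrel P) u v.
Proof.
have e := @eqmodP _ weq_equiv_rel u v.
by split=> [/e/asboolP|/asboolP/e].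
Qed.

Definition word_repr (g : word_group) : seq T := repr (g : {eq_quot weq}).

Lemma word_reprK : cancel word_repr word_class.
Proof. by move=> g; rewrite /word_class reprK. Qed.

Definition word_inv w := rev (map (winv P) w).

Lemma word_invr w : wcong (wrel P) (w ++ word_inv w) [::].
Proof.
elim: w => [|a w IH]; first exact: wcong_refl.
rewrite /word_inv /= rev_cons -cats1 catA -[a :: _]/([:: a] ++ _) catA.
apply: wcong_trans (winvr P a); rewrite -[[:: a; _]]/([:: a] ++ [:: _]).
apply: wcong_cat; last exact: wcong_refl.
rewrite -[in X in wcong _ _ X](cats0 [:: a]).
rewrite -/(word_inv w) -?catA; apply: wcong_cat IH; exact: wcong_refl.
Qed.

Lemma word_invl w : wcong (wrel P) (word_inv w ++ w) [::].
Proof.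
elim: w => [|a w IH]; first exact: wcong_refl.
rewrite /word_inv /= rev_cons -cats1 -/(word_inv w).
apply: wcong_trans IH; rewrite -catA.
apply: wcong_cat; first exact: wcong_refl.
rewrite -[w in X in wcong _ _ X]cat0s -[a :: w]/([:: a] ++ w) catA.
by apply: wcong_cat (wcong_refl _ _); exact: winvl.
Qed.

Definition wmul (g h : word_group) := word_class (word_repr g ++ word_repr h).
Definition wone := word_class [::].
Definition winvg (g : word_group) := word_class (word_inv (word_repr g)).

Lemma wmulE u v : wmul (word_class u) (word_class v) = word_class (u ++ v).
Proof.
by apply/word_classP; apply: wcong_cat; apply/word_classP; rewrite word_reprK.
Qed.

Lemma wmulA : associative wmul.
Proof.
move=> a b c; rewrite -(word_reprK a) -(word_reprK b) -(word_reprK c).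
by rewrite !wmulE catA.
Qed.

Lemma wmul1 : left_id wone wmul.
Proof. by move=> a; rewrite -(word_reprK a) wmulE. Qed.

Lemma w1mul : right_id wone wmul.
Proof. by move=> a; rewrite -(word_reprK a) wmulE cats0. Qed.

Lemma wmulV : left_inverse wone winvg wmul.
Proof.
move=> a; rewrite -{2}(word_reprK a) wmulE; apply/word_classP.
exact: word_invl.
Qed.

Lemma wVmul : right_inverse wone winvg wmul.
Proof.
move=> a; rewrite -{1}(word_reprK a) wmulE; apply/word_classP.
exact: word_invr.
Qed.

HB.instance Definition _ :=
  isGroup.Build word_group wmulA wmul1 w1mul wmulV wVmul.

Lemma word_classM u v : word_class (u ++ v) = word_class u * word_class v.
Proof. by rewrite -wmulE. Qed.

End WordGroup.

(* The letter (x, true) is x and (x, false) is its inverse. *)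
Section FreeGroup.
Variable X : choiceType.

Variant free_rel : seq (X * bool) -> seq (X * bool) -> Prop :=
| FreeCancel x b : free_rel [:: (x, b); (x, ~~ b)] [::].

Definition free_inv (a : X * bool) := (a.1, ~~ a.2).

Lemma free_invr a : wcong free_rel [:: a; free_inv a] [::].
Proof. by case: a => x b; apply: wcong_rel. Qed.

Lemma free_invl a : wcong free_rel [:: free_inv a; a] [::].
Proof.
case: a => x []; apply: wcong_rel.
- exact: (FreeCancel x false).
- exact: (FreeCancel x true).
Qed.

Definition free_pres := WordPres free_invr free_invl.

Definition free_group : Type := word_group free_pres.
HB.instance Definition _ := Group.on free_group.

Definition free_gen (x : X) : free_group := word_class free_pres [:: (x, true)].

Definition letter_sum (w : seq (X * bool)) : int :=
  (\sum_(a <- w) (if a.2 then 1 else -1))%R.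

Lemma letter_sum_wcong u v : wcong free_rel u v -> letter_sum u = letter_sum v.
Proof.
elim=> {u v} //.
- by move=> _ _ [x []]; rewrite /letter_sum !big_cons !big_nil.
- by move=> u v w _ -> _ ->.
- by move=> u u' v v' _ uu' _ vv'; move: uu' vv';
    rewrite /letter_sum !big_cat /= => -> ->.
Qed.

Definition exponent_sum (g : free_group) : int := letter_sum (word_repr g).

Lemma exponent_sumM g h :
  exponent_sum (g * h) = (exponent_sum g + exponent_sum h)%R.
Proof.
rewrite /exponent_sum /letter_sum -big_cat /=; apply: letter_sum_wcong.
by apply/(word_classP free_pres); rewrite word_reprK.
Qed.

Lemma exponent_sum_gen x : exponent_sum (free_gen x) = 1%R.
Proof.
transitivity (letter_sum [:: (x, true)]).
  apply: letter_sum_wcong; apply/(word_classP free_pres).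
  by rewrite word_reprK.
by rewrite /letter_sum big_seq1.
Qed.

Definition balanced (R : set free_group) : Prop :=
  forall r, R r -> exponent_sum r = 0%R.

End FreeGroup.

Section FreeProduct.
Variables G K : groupType.

Variant free_prod_rel : seq (G + K) -> seq (G + K) -> Prop :=
| FreeProdMull g h : free_prod_rel [:: inl g; inl h] [:: inl (g * h)]
| FreeProdMulr g h : free_prod_rel [:: inr g; inr h] [:: inr (g * h)]
| FreeProd1l : free_prod_rel [:: inl 1] [::]
| FreeProd1r : free_prod_rel [:: inr 1] [::].

Definition free_prod_inv (a : G + K) : G + K :=
  match a with inl g => inl g^-1 | inr g => inr g^-1 end.

Lemma free_prod_invr a : wcong free_prod_rel [:: a; free_prod_inv a] [::].
Proof.
case: a => g /=.
- apply: wcong_trans (wcong_rel FreeProd1l); rewrite -(mulgV g).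
  exact: wcong_rel (FreeProdMull _ _).
- apply: wcong_trans (wcong_rel FreeProd1r); rewrite -(mulgV g).
  exact: wcong_rel (FreeProdMulr _ _).
Qed.

Lemma free_prod_invl a : wcong free_prod_rel [:: free_prod_inv a; a] [::].
Proof.
case: a => g /=.
- apply: wcong_trans (wcong_rel FreeProd1l); rewrite -(mulVg g).
  exact: wcong_rel (FreeProdMull _ _).
- apply: wcong_trans (wcong_rel FreeProd1r); rewrite -(mulVg g).
  exact: wcong_rel (FreeProdMulr _ _).
Qed.

Definition free_prod_pres := WordPres free_prod_invr free_prod_invl.

Definition free_prod : Type := word_group free_prod_pres.
HB.instance Definition _ := Group.on free_prod.

Definition free_inl (g : G) : free_prod :=
  word_class free_prod_pres [:: inl g].
Definition free_inr (g : K) : free_prod :=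
  word_class free_prod_pres [:: inr g].

Lemma free_inlM : group_hom free_inl.
Proof.
move=> g h; rewrite /free_inl -[RHS]word_classM; apply/word_classP.
exact/wcong_sym/wcong_rel/(FreeProdMull _ _).
Qed.

Lemma free_inrM : group_hom free_inr.
Proof.
move=> g h; rewrite /free_inr -[RHS]word_classM; apply/word_classP.
exact/wcong_sym/wcong_rel/(FreeProdMulr _ _).
Qed.

End FreeProduct.

Section GroupQuotient.
Variables (G : groupType) (S : set G).

Lemma normal_closure_normal : normal_subgroup_set (normal_closure S).
Proof.
split; [split|].
- by move=> N [[[]]].
- by move=> x y Nx Ny N NS; case: (NS) => -[[_ + _] _] _; apply;
    [exact: Nx|exact: Ny].
- by move=> x Nx N NS; case: (NS) => -[[_ _ +] _] _; apply; exact: Nx.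
- by move=> x g Nx N NS; case: (NS) => -[_ +] _; apply; exact: Nx.
Qed.

Definition coset_rel : rel G := fun x y => `[< normal_closure S (x^-1 * y) >].

Lemma coset_rel_equiv : equiv_class_of coset_rel.
Proof.
have [[N1 NM NV] _] := normal_closure_normal.
have sym x y : coset_rel x y -> coset_rel y x.
  by move=> /asboolP/NV; rewrite invgM invgK => xy; apply/asboolP.
split=> [x|x y|y x z]; first by apply/asboolP; rewrite mulVg.
- by apply/idP/idP; exact: sym.
- move=> /asboolP xy /asboolP yz; apply/asboolP.
  by have := NM _ _ xy yz; rewrite mulgA mulgK.
Qed.

Canonical coset_equiv_rel := EquivRelPack coset_rel_equiv.

(* The quotient of G by the normal closure of S. *)
Definition group_quot : Type := {eq_quot coset_rel}.
HB.instance Definition _ := Choice.copy group_quot {eq_quot coset_rel}.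
HB.instance Definition _ := Quotient.copy group_quot {eq_quot coset_rel}.

Definition quot_proj (x : G) : group_quot := \pi_group_quot x.

Lemma quot_projP x y :
  quot_proj x = quot_proj y <-> normal_closure S (x^-1 * y).
Proof.
have e := @eqmodP _ coset_equiv_rel x y.
by split=> [/e/asboolP|/asboolP/e].
Qed.

Definition quot_repr (q : group_quot) : G := repr q.

Lemma quot_reprK : cancel quot_repr quot_proj.
Proof. by move=> q; rewrite /quot_proj reprK. Qed.

Definition quot_mul (a b : group_quot) := quot_proj (quot_repr a * quot_repr b).
Definition quot_inv (a : group_quot) := quot_proj (quot_repr a)^-1.

Lemma quot_mulE x y : quot_mul (quot_proj x) (quot_proj y) = quot_proj (x * y).
Proof.
have [[N1 NM NV] NJ] := normal_closure_normal.
rewrite /quot_mul; apply/quot_projP.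
have /quot_projP xx := quot_reprK (quot_proj x).
have /quot_projP yy := quot_reprK (quot_proj y).
set x' := quot_repr _ in xx *; set y' := quot_repr _ in yy *.
have := NM _ _ (NJ _ y'^-1 xx) yy.
by rewrite invgK invgM !mulgA mulgK.
Qed.

Lemma quot_invE x : quot_inv (quot_proj x) = quot_proj x^-1.
Proof.
have [[N1 NM NV] NJ] := normal_closure_normal.
rewrite /quot_inv; apply/quot_projP.
have /esym/quot_projP xx := quot_reprK (quot_proj x).
have := NJ _ x xx.
by rewrite mulgA mulgV mul1g invgK.
Qed.

Lemma quot_mulA : associative quot_mul.
Proof.
move=> a b c; rewrite -(quot_reprK a) -(quot_reprK b) -(quot_reprK c).
by rewrite !quot_mulE mulgA.
Qed.

Lemma quot_mul1 : left_id (quot_proj 1) quot_mul.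
Proof. by move=> a; rewrite -(quot_reprK a) quot_mulE mul1g. Qed.

Lemma quot_1mul : right_id (quot_proj 1) quot_mul.
Proof. by move=> a; rewrite -(quot_reprK a) quot_mulE mulg1. Qed.

Lemma quot_mulV : left_inverse (quot_proj 1) quot_inv quot_mul.
Proof.
by move=> a; rewrite -(quot_reprK a) quot_invE quot_mulE mulVg.
Qed.

Lemma quot_Vmul : right_inverse (quot_proj 1) quot_inv quot_mul.
Proof.
by move=> a; rewrite -(quot_reprK a) quot_invE quot_mulE mulgV.
Qed.

HB.instance Definition _ :=
  isGroup.Build group_quot quot_mulA quot_mul1 quot_1mul quot_mulV quot_Vmul.

Lemma quot_projM : group_hom quot_proj.
Proof. by move=> x y; rewrite -quot_mulE. Qed.

End GroupQuotient.

Section HnnGroup.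
Variables (U : topGroupType) (phi : openMono U) (X : finType).

Definition hnn_relators : set (free_prod U (free_group X)) :=
  [set r | exists x w, om_dom phi w /\
     r = free_inr U (free_gen x) * free_inl (free_group X) w
         * (free_inr U (free_gen x))^-1 * (free_inl (free_group X) (phi w))^-1].

Definition hnn : Type := group_quot hnn_relators.
HB.instance Definition _ := Group.copy hnn (group_quot hnn_relators).

Definition hnn_U (u : U) : hnn := quot_proj hnn_relators (free_inl _ u).
Definition hnn_F (g : free_group X) : hnn :=
  quot_proj hnn_relators (free_inr U g).
Definition hnn_t (x : X) : hnn := hnn_F (free_gen x).

Lemma hnn_UM : group_hom hnn_U.
Proof. by move=> u v; rewrite /hnn_U free_inlM [LHS]quot_projM. Qed.

Lemma hnn_FM : group_hom hnn_F.
Proof. by move=> u v; rewrite /hnn_F free_inrM [LHS]quot_projM. Qed.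

End HnnGroup.
Arguments hnn_relators {U} phi X _.
Arguments hnn_U {U} phi X u.
Arguments hnn_F {U} phi {X} g.
Arguments hnn_t {U} phi {X} x.

Lemma om_fun1 (U : topGroupType) (phi : openMono U) : phi 1 = 1.
Proof.
have [O1 _ _] := om_dom_subgroup phi.
have := @om_morph U phi 1 1 (mem_set O1) (mem_set O1); rewrite mulg1 => e.
by apply: (mulgI (phi 1)); rewrite -e mulg1.
Qed.

Section TopologicalGroupTheory.
Variable G : topGroupType.
Implicit Types a b : G.

Lemma nbhs_mulg a b (W : set G) : nbhs (a * b) W ->
  exists A B, [/\ nbhs a A, nbhs b B & forall x y, A x -> B y -> W (x * y)].
Proof.
move=> /(@mulg_continuous G (a, b)) [[A B] /= [nA nB] AB].
by exists A, B; split=> // x y Ax By; exact: (AB (x, y)).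
Qed.

Lemma lmulg_continuous a : continuous (fun x => a * x).
Proof.
move=> x W /nbhs_mulg [A [B [nA nB AB]]].
by apply: filterS nB => y By; apply: AB => //; exact: nbhs_singleton.
Qed.

Lemma rmulg_continuous a : continuous (fun x => x * a).
Proof.
move=> x W /nbhs_mulg [A [B [nA nB AB]]].
by apply: filterS nA => y Ay; apply: AB => //; exact: nbhs_singleton.
Qed.

End TopologicalGroupTheory.

(* A subset W of the HNN-type extension is declared open when every left
   translate of W meets the base group in an open set. [hnn_topGroup] below makes
   this a group topology, [hnn_U_continuous] and [hnn_U_open] show that the
   canonical map from U is continuous and open, and [hnn_topology_unique]
   that it is the only such topology. *)
Section HnnTopology.
Variables (U : topGroupType) (phi : openMono U) (X : finType).
Local Notation H := (hnn phi X).
Local Notation i := (hnn_U phi X).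

Definition hnn_open (W : set H) : Prop :=
  forall h : H, open [set u : U | W (h * i u)].

Lemma hnn_openT : hnn_open setT.
Proof. by move=> h; exact: openT. Qed.

Lemma hnn_openI : setI_closed hnn_open.
Proof. by move=> A B oA oB h; exact: openI (oA h) (oB h). Qed.

Lemma hnn_open_bigU (I : Type) (f : I -> set H) :
  (forall k, hnn_open (f k)) -> hnn_open (\bigcup_k f k).
Proof.
by move=> of_ h; have := bigcup_open (fun k (_ : setT k) => of_ k h).
Qed.

HB.instance Definition _ :=
  isOpenTopological.Build H hnn_openT hnn_openI hnn_open_bigU.

Lemma hnn_openE (W : set H) : open W = hnn_open W.
Proof. by []. Qed.

Lemma hnn_U1 : i 1 = 1.
Proof. by apply: (mulgI (i 1)); rewrite -hnn_UM !mulg1. Qed.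

Lemma hnn_UV u : i u^-1 = (i u)^-1.
Proof. by apply: (mulgI (i u)); rewrite -hnn_UM !mulgV hnn_U1. Qed.

Lemma hnn_t_conj x w : om_dom phi w ->
  hnn_t phi x * i w * (hnn_t phi x)^-1 = i (phi w).
Proof.
move=> Ow; apply: divg1_eq.
have projV (g : free_prod U (free_group X)) :
    quot_proj (hnn_relators phi X) g^-1 = (quot_proj _ g : H)^-1.
  apply: (mulgI (quot_proj _ g : H)).
  by rewrite -[LHS]quot_projM !mulgV.
pose r := free_inr U (free_gen x) * free_inl (free_group X) w
  * (free_inr U (free_gen x))^-1 * (free_inl (free_group X) (phi w))^-1.
transitivity (quot_proj (hnn_relators phi X) r : H).
  by rewrite /r [RHS]quot_projM projV [X in _ = X * _]quot_projM projV
    [X in _ = X * _ * _]quot_projM.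
apply/esym; rewrite -[1]/(quot_proj (hnn_relators phi X) 1).
apply/quot_projP; rewrite invg1 mul1g.
by apply: sub_gen_smallest; exists x, w.
Qed.

Lemma hnn_ind (P : H -> Prop) :
    P 1 -> (forall g h, P g -> P h -> P (g * h)) ->
    (forall u, P (i u)) ->
    (forall x, P (hnn_t phi x)) -> (forall x, P (hnn_t phi x)^-1) ->
  forall h, P h.
Proof.
move=> P1 PM PU Pt PV h; rewrite -(quot_reprK h); set g := quot_repr h.
rewrite -(word_reprK g); elim: (word_repr g) => [|a w IH] //.
rewrite -cat1s word_classM [quot_proj _ _]quot_projM; apply: (PM) => //.
case: a => [u|f]; first exact: PU.
rewrite -[quot_proj _ _]/(hnn_F phi f) -(word_reprK f).
have F1 : hnn_F phi (1 : free_group X) = 1.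
  by apply: (mulgI (hnn_F phi 1)); rewrite -hnn_FM !mulg1.
elim: (word_repr f) => [|[x b] v IHv]; first by rewrite -[word_class _ _]/(1 : free_group X) F1.
rewrite -cat1s word_classM hnn_FM; apply: (PM) => //.
case: b; first exact: Pt.
suff -> : hnn_F phi (word_class (free_pres X) [:: (x, false)]) = (hnn_t phi x)^-1.
  exact: PV.
apply: (mulgI (hnn_t phi x)); rewrite mulgV -hnn_FM -F1; congr hnn_F.
rewrite -[LHS]word_classM; apply/word_classP; apply: wcong_rel.
exact: (FreeCancel x true).
Qed.

Lemma hnn_U_continuous : continuous i.
Proof.
apply/continuousP => W oW; have := oW 1.
by congr (open _); apply/seteqP; split=> u /=; rewrite mul1g.
Qed.

Lemma hnn_translate_open (g : H) (V : set U) :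
  open V -> open [set g * i v | v in V].
Proof.
move=> oV; rewrite hnn_openE => h; rewrite openE => u0 /= [v0 Vv0 e].
have : nbhs u0 [set u | V (v0 * u0^-1 * u)].
  apply: (lmulg_continuous (x := u0)); rewrite mulgVK.
  exact: open_nbhs_nbhs.
apply: filterS => u /= Vu; exists (v0 * u0^-1 * u) => //.
by rewrite !hnn_UM mulgA mulgA e hnn_UV mulgK.
Qed.

Lemma hnn_U_open : open_map i.
Proof.
move=> V oV; have := hnn_translate_open 1 oV.
by congr (open _); apply/seteqP; split=> _ [v Vv <-]; exists v => //;
  rewrite mul1g.
Qed.

Lemma hnn_nbhsP (h : H) (W : set H) :
  nbhs h W <-> nbhs (1 : U) [set u | W (h * i u)].
Proof.
split.
- rewrite !nbhsE => -[B [oB Bh] BW].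
  exists [set u | B (h * i u)]; last by move=> u /BW.
  by split; [exact: oB|rewrite /= hnn_U1 mulg1].
- rewrite nbhsE => -[V [oV V1] VW].
  rewrite nbhsE; exists [set h * i v | v in V]; last by move=> _ [v /VW ? <-].
  by split; [exact: hnn_translate_open|exists 1 => //; rewrite hnn_U1 mulg1].
Qed.

Lemma hnn_conj_nbhs (h : H) (V : set U) : nbhs 1 V ->
  exists2 V', nbhs 1 V' & forall v, V' v -> exists2 v', V v' &
    h * i v * h^-1 = i v'.
Proof.
move: V; elim/hnn_ind: h.
- move=> V nV; exists V => // v Vv; exists v => //.
  by rewrite invg1 mul1g mulg1.
- move=> g h IHg IHh V /IHg [V1 nV1 V1P]; have [V2 nV2 V2P] := IHh _ nV1.
  exists V2 => // v /V2P [v1 /V1P [v2 Vv2 e2] e1]; exists v2 => //.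
  by rewrite -e2 -e1 invgM !mulgA.
- move=> a V nV; exists [set u | V (a * u * a^-1)].
    have : nbhs (a * 1 * a^-1) V by rewrite mulg1 mulgV.
    by move=> /rmulg_continuous /(lmulg_continuous (x := 1)).
  move=> v Vv; exists (a * v * a^-1) => //.
  by rewrite !hnn_UM hnn_UV.
- move=> x V nV.
  exists [set w | om_dom phi w /\ V (phi w)]; last first.
    by move=> w [Ow Vw]; exists (phi w) => //; exact: hnn_t_conj.
  have [O1 _ _] := om_dom_subgroup phi.
  have nO : nbhs 1 (om_dom phi).
    by apply: open_nbhs_nbhs; split=> //; exact: om_dom_open.
  have nV1 : nbhs 1 (phi @^-1` V).
    have := @om_continuous U phi; rewrite continuous_open_subspace; last exact: om_dom_open.
    by move=> /(_ 1 (mem_set O1)); apply; rewrite /= om_fun1.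
  exact: filterI nO nV1.
- move=> x V nV.
  have [O1 _ _] := om_dom_subgroup phi.
  move: nV; rewrite {1}nbhsE => -[B [oB B1] BV].
  exists (phi @` (om_dom phi `&` B)).
    rewrite -(om_fun1 phi); apply: open_nbhs_nbhs; split; last by exists 1.
    apply: om_open; first exact: subIsetl.
    by apply: openI => //; exact: om_dom_open.
  move=> _ [w [Ow Bw] <-]; exists w; first exact: BV.
  by rewrite -(hnn_t_conj x Ow) invgK !mulgA mulVg mul1g mulgVK.
Qed.

Lemma hnn_mulg_continuous : continuous (fun z : H * H => z.1 * z.2).
Proof.
move=> [a b] W /= /hnn_nbhsP nW.
have : nbhs ((1 : U) * 1) [set u | W (a * b * i u)] by rewrite mulg1.
move=> /nbhs_mulg [A [B [nA nB AB]]].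
have [V nV VA] := hnn_conj_nbhs b^-1 nA.
exists ([set a * i v | v in V], [set b * i v | v in B]).
  split=> /=; apply/hnn_nbhsP.
  - by apply: filterS nV => v Vv /=; exists v.
  - by apply: filterS nB => v Bv /=; exists v.
move=> [_ _] /= [[v /VA [v' Av' e] <-] [w Bw <-]].
have := AB _ _ Av' Bw; rewrite /= hnn_UM -e invgK.
by rewrite !mulgA mulgK.
Qed.

Lemma hnn_invg_continuous : continuous (fun h : H => h^-1).
Proof.
move=> h W /= /hnn_nbhsP nW.
have [V nV VP] := hnn_conj_nbhs h nW.
apply/hnn_nbhsP; have : nbhs (1 : U) [set u | V u^-1].
  by apply: invg_continuous; rewrite invg1.
apply: filterS => u /= /VP [v Wv e].
have : W (h^-1 * i v) by [].
by rewrite -e hnn_UV invgM !mulgA mulVg mul1g.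
Qed.

HB.instance Definition hnn_topGroup :=
  isTopologicalGroup.Build H hnn_mulg_continuous hnn_invg_continuous.

Lemma hnn_topology_unique (T : topGroupType) (f : H -> T) :
  group_hom f -> bijective f -> continuous (f \o i) -> open_map (f \o i) ->
  forall W : set T, open W <-> open (f @^-1` W).
Proof.
move=> fM [g fK gK] ctn opn W; split=> [oW|].
- rewrite hnn_openE => h.
  have /continuousP/(_ _ oW) : continuous (( *%g (f h)) \o (f \o i)).
    by move=> u; apply: continuous_comp; [exact: ctn|exact: lmulg_continuous].
  by congr (open _); apply/seteqP; split=> u /=; rewrite fM.
- rewrite hnn_openE => oW; rewrite openE => y Wy.
  have /opn oV := oW (g y).
  have : nbhs (1 : T) [set z | W (y * z)].
    apply: filterS (open_nbhs_nbhs (conj oV _)); last first.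
      exists 1; rewrite /= hnn_U1 ?mulg1 ?gK //.
      by apply: (mulgI (f 1)); rewrite -fM !mulg1.
    move=> _ [u /= + <-].
    by rewrite fM gK.
  rewrite -(mulVg y) => nW.
  have : nbhs y [set z | W (y * (y^-1 * z))] by exact: lmulg_continuous nW.
  by apply: filterS => z /=; rewrite mulVKg.
Qed.

End HnnTopology.

Section GeneralisedPresentation.
Variables (U : topGroupType) (phi : openMono U) (X : finType).
Variable R : set (free_group X).

Definition gen_relators : set (hnn phi X) := [set hnn_F phi r | r in R].

Definition gen_group : Type := quotient_topology (group_quot gen_relators).
HB.instance Definition _ :=
  Topological.copy gen_group (quotient_topology (group_quot gen_relators)).
HB.instance Definition _ := Group.copy gen_group (group_quot gen_relators).

Definition gen_proj (h : hnn phi X) : gen_group := quot_proj gen_relators h.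
Definition gen_U (u : U) : gen_group := gen_proj (hnn_U phi X u).
Definition gen_X (x : X) : gen_group := gen_proj (hnn_t phi x).

Lemma gen_projM : group_hom gen_proj.
Proof. exact: quot_projM. Qed.

Lemma gen_proj_surj (g : gen_group) : exists h, gen_proj h = g.
Proof. by exists (quot_repr g); exact: quot_reprK. Qed.

Lemma gen_openE (W : set gen_group) : open W = open (gen_proj @^-1` W).
Proof. by []. Qed.

Lemma gen_proj_continuous : continuous gen_proj.
Proof. exact/continuousP. Qed.

Lemma gen_projV h : gen_proj h^-1 = (gen_proj h)^-1.
Proof. exact: esym (quot_invE _ h). Qed.

Lemma gen_proj_open : open_map gen_proj.
Proof.
move=> W oW; rewrite gen_openE openE => h [w Ww e].
have : nbhs h [set z | W (w * h^-1 * z)].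
  apply: (lmulg_continuous (x := h)); rewrite mulgVK.
  exact: open_nbhs_nbhs.
apply: filterS => z /= Wz; exists (w * h^-1 * z) => //.
by rewrite !gen_projM gen_projV e mulgV mul1g.
Qed.

Lemma gen_proj_nbhs h (A : set (hnn phi X)) :
  nbhs h A -> nbhs (gen_proj h) (gen_proj @` A).
Proof.
rewrite {1}nbhsE => -[B [oB Bh] BA].
apply: (@filterS _ (nbhs (gen_proj h)) _ (gen_proj @` B)).
  exact: image_subset.
apply: open_nbhs_nbhs.
by split; [exact: gen_proj_open|exists h].
Qed.

Lemma gen_mulg_continuous : continuous (fun z : gen_group * gen_group => z.1 * z.2).
Proof.
move=> [a b] W /=.
have [h <-] := gen_proj_surj a; have [k <-] := gen_proj_surj b.
rewrite -gen_projM => /gen_proj_continuous /nbhs_mulg [A [B [nA nB AB]]].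
exists (gen_proj @` A, gen_proj @` B); first by split; exact: gen_proj_nbhs.
by move=> [_ _] /= [[x Ax <-] [y By <-]]; rewrite -gen_projM; exact: AB.
Qed.

Lemma gen_invg_continuous : continuous (fun g : gen_group => g^-1).
Proof.
move=> a W /=; have [h <-] := gen_proj_surj a.
rewrite -gen_projV => /gen_proj_continuous /invg_continuous /gen_proj_nbhs.
by apply: filterS => _ [x /= Wx <-]; rewrite -gen_projV.
Qed.

HB.instance Definition _ :=
  isTopologicalGroup.Build gen_group gen_mulg_continuous gen_invg_continuous.

Definition can_be_generalised : Prop := injective gen_U.

End GeneralisedPresentation.

Arguments gen_U {U} phi {X} R u.
Arguments gen_X {U} phi {X} R x.

(* Main.v *)
(** The assignment [u |-> u], [x |-> t] respects the relators because a balanced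
    word is sent to [t ^+ 0]; this gives [psi], and [t |-> x] gives a section
    [j_x] of it.  Everything else rests on the injectivity of the map from [U] to
    [hnn phi X].  Rather than with Britton's normal forms, it is obtained by
    letting [U] act freely on [U * (nat -> A) * (nat -> B)], where [A] and [B]
    are right transversals of [O] and [phi O]: writing [g = o a] with [o] in [O]
    and [a] in [A], the bijection
      [(o a, alpha, b :: beta) |-> (phi(o) b, a :: alpha, beta)]
    conjugates the action of [w] in [O] to that of [phi w].  Hence [U] is an open
    Hausdorff subgroup of the group defined by the generalised presentation,
    which is therefore Hausdorff, and the image of a continuous retraction of a
    Hausdorff space is closed. *)
Require Import Defs.
From HB Require Import structures.
From mathcomp Require Import all_boot all_algebra all_classical.
From mathcomp Require Import topology.

Set Implicit Arguments.
Unset Strict Implicit.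
Unset Printing Implicit Defensive.

Local Open Scope classical_set_scope.
Local Open Scope group_scope.

(** * Universal properties: quotients, word groups, HNN-type extensions *)

Section GroupHom.
Variables (G H : groupType) (f : G -> H).
Hypothesis fM : group_hom f.

Lemma group_hom1 : f 1 = 1.
Proof. by apply: (mulgI (f 1)); rewrite -fM !mulg1. Qed.

Lemma group_homV x : f x^-1 = (f x)^-1.
Proof. by apply: (mulgI (f x)); rewrite -fM !mulgV group_hom1. Qed.

Lemma normal_closure_ker (S : set G) : (forall s, S s -> f s = 1) ->
  forall g, normal_closure S g -> f g = 1.
Proof.
move=> fS g /(_ [set x | f x = 1]); apply; split=> //.
split; [split|] => [|x y|x|x h].
- exact: group_hom1.
- by rewrite /= fM => -> ->; rewrite mulg1.
- by rewrite /= group_homV => ->; rewrite invg1.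
- by rewrite /= !fM group_homV => ->; rewrite mulg1 mulgV.
Qed.

Lemma quot_lift (S : set G) : (forall s, S s -> f s = 1) ->
  exists F : group_quot S -> H,
    group_hom F /\ forall g, F (quot_proj S g) = f g.
Proof.
move=> fS; pose F (q : group_quot S) := f (quot_repr q).
have FE g : F (quot_proj S g) = f g.
  have /quot_projP/(normal_closure_ker fS) := quot_reprK (quot_proj S g).
  by rewrite fM group_homV => /mulg1_eq; rewrite invgK.
exists F; split=> // a b.
by rewrite -(quot_reprK a) -(quot_reprK b) -[_ * _]quot_projM !FE.
Qed.

End GroupHom.

Lemma word_lift (T : choiceType) (P : wordPres T) (H : groupType) (f : T -> H) :
  (forall u v, wrel P u v -> \prod_(a <- u) f a = \prod_(a <- v) f a) ->
  exists F : word_group P -> H,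
    group_hom F /\ forall w, F (word_class P w) = \prod_(a <- w) f a.
Proof.
move=> fP; pose F (g : word_group P) := \prod_(a <- word_repr g) f a.
have FE w : F (word_class P w) = \prod_(a <- w) f a.
  have /word_classP := word_reprK (word_class P w).
  rewrite /F; move: (word_repr _) => w'.
  elim=> {w w'} [u v /fP||//|u v w _ -> _ ->|u u' v v' _ uu' _ vv'] //.
  by rewrite !big_cat /= uu' vv'.
exists F; split=> // a b.
by rewrite -(word_reprK a) -(word_reprK b) -word_classM !FE big_cat.
Qed.

Lemma free_lift (X : choiceType) (H : groupType) (t : X -> H) :
  exists F : free_group X -> H,
    group_hom F /\ forall x, F (free_gen x) = t x.
Proof.
have [|F [FM FE]] := @word_lift _ (free_pres X) H
    (fun a => if a.2 then t a.1 else (t a.1)^-1).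
  move=> _ _ [x b]; rewrite !big_cons !big_nil mulg1.
  by case: b; rewrite /= ?mulgV ?mulVg.
by exists F; split=> // x; rewrite FE big_seq1.
Qed.

Lemma free_prod_lift (G K H : groupType) (f : G -> H) (g : K -> H) :
  group_hom f -> group_hom g ->
  exists F : free_prod G K -> H,
    [/\ group_hom F, forall x, F (free_inl K x) = f x &
        forall y, F (free_inr G y) = g y].
Proof.
move=> fM gM; have [|F [FM FE]] := @word_lift _ (free_prod_pres G K) H
    (fun a => match a with inl x => f x | inr y => g y end).
  move=> _ _ [x y|x y||]; rewrite !big_cons !big_nil !mulg1 ?fM ?gM //.
  - exact: group_hom1.
  - exact: group_hom1.
by exists F; split=> // x; rewrite FE big_seq1.
Qed.

(** As all generators have the same image [t], a word is sent to [t] raised to its exponent sum; in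
    [fE] below, [n] and [m] count the positive and the negative letters. *)
Lemma balanced_ker (X : choiceType) (H : groupType) (f : free_group X -> H)
    (t : H) : group_hom f -> (forall x, f (free_gen x) = t) ->
  forall r, exponent_sum r = 0%R -> f r = 1.
Proof.
move=> fM ft.
have fV x : f (word_class (free_pres X) [:: (x, false)]) = t^-1.
  rewrite -(ft x) -group_homV //; congr f.
  apply/esym/mulg1_eq; rewrite -[LHS]word_classM.
  exact/word_classP/wcong_rel/(FreeCancel x true).
(* Exponents are kept in [nat]: no integer powers are available here. *)
have fE w : exists m n : nat,
    letter_sum w = (n%:Z - m%:Z)%R /\
    f (word_class (free_pres X) w) * t ^+ m = t ^+ n.
  elim: w => [|[x b] w [m [n [sE fE]]]].
    exists 0, 0; rewrite /letter_sum big_nil; split=> //.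
    by rewrite -[word_class _ _]/(1 : free_group X) (group_hom1 fM) mul1g.
  have -> : f (word_class (free_pres X) ((x, b) :: w)) =
      (if b then t else t^-1) * f (word_class (free_pres X) w).
    rewrite -cat1s word_classM [LHS]fM; congr (_ * _).
    by case: b; [exact: ft|exact: fV].
  have -> : letter_sum ((x, b) :: w) =
      ((if b then 1 else -1) + letter_sum w)%R.
    by rewrite /letter_sum big_cons.
  case: b; [exists m, n.+1|exists m.+1, n]; rewrite sE; split.
  - by rewrite intS GRing.addrA.
  - by rewrite -mulgA fE expgS.
  - by rewrite intS GRing.opprD GRing.addrCA.
  - by rewrite expgSr mulgA -(mulgA t^-1) fE -mulgA -expgSr expgS mulKg.
move=> r; rewrite /exponent_sum -{2}(word_reprK r).
have [m [n [-> e]]] := fE (word_repr r).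
move=> /eqP; rewrite GRing.subr_eq0 => /eqP[nm].
by move: e; rewrite nm => /esym e; apply: (mulIg (t ^+ m)); rewrite mul1g.
Qed.

Lemma hnn_lift (U : topGroupType) (phi : openMono U) (X : finType)
    (H : groupType) (f : U -> H) (t : X -> H) :
  group_hom f ->
  (forall x w, om_dom phi w -> t x * f w * (t x)^-1 = f (phi w)) ->
  exists F : hnn phi X -> H,
    [/\ group_hom F, forall u, F (hnn_U phi X u) = f u &
        forall x, F (hnn_t phi x) = t x].
Proof.
move=> fM tf; have [g [gM gt]] := free_lift t.
have [F0 [F0M F0l F0r]] := free_prod_lift fM gM.
have [|F [FM FE]] := quot_lift F0M (S := hnn_relators phi X).
  move=> _ [x [w [Ow ->]]]; rewrite !F0M !(group_homV F0M) !F0l !F0r gt tf //.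
  by rewrite mulgV.
exists F; split=> //.
- by move=> u; rewrite [LHS]FE F0l.
- by move=> x; rewrite [LHS]FE F0r gt.
Qed.

(** * The group of bijections of a type *)

Record bijection (S : Type) := Bijection {
  bij_fun :> S -> S;
  bij_inv : S -> S;
  bij_funK : cancel bij_fun bij_inv;
  bij_invK : cancel bij_inv bij_fun
}.

Section BijectionGroup.
Variable S : Type.
Implicit Types f g h : bijection S.

(** The inverse stored in the record is determined by the function, so it adds no information. *)
Lemma bijection_ext f g : f =1 g -> f = g.
Proof.
case: f g => [f f' fK f'K] [g g' gK g'K] /= /funext fg.
rewrite -{}fg in gK g'K *.
have e : f' = g' by apply/funext => s; rewrite -{1}(g'K s) fK.
by rewrite -{}e in gK g'K *; congr Bijection; exact: Prop_irrelevance.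
Qed.

HB.instance Definition _ := gen_eqMixin (bijection S).
HB.instance Definition _ := gen_choiceMixin (bijection S).

Definition bij_mul f g : bijection S :=
  Bijection (can_comp (bij_funK f) (bij_funK g))
            (can_comp (bij_invK g) (bij_invK f)).

Definition bij_one : bijection S :=
  @Bijection S id id (fun=> erefl) (fun=> erefl).

Definition bij_invg f : bijection S := Bijection (bij_invK f) (bij_funK f).

Lemma bij_mulA : associative bij_mul.
Proof. by move=> f g h; exact: bijection_ext. Qed.

Lemma bij_mul1 : left_id bij_one bij_mul.
Proof. by move=> f; exact: bijection_ext. Qed.

Lemma bij_1mul : right_id bij_one bij_mul.
Proof. by move=> f; exact: bijection_ext. Qed.

Lemma bij_mulV : left_inverse bij_one bij_invg bij_mul.
Proof. by move=> f; apply: bijection_ext => s; exact: bij_funK. Qed.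

Lemma bij_Vmul : right_inverse bij_one bij_invg bij_mul.
Proof. by move=> f; apply: bijection_ext => s; exact: bij_invK. Qed.

HB.instance Definition _ :=
  isGroup.Build (bijection S) bij_mulA bij_mul1 bij_1mul bij_mulV bij_Vmul.

Lemma bij_mulE f g s : (f * g) s = f (g s).
Proof. by []. Qed.

End BijectionGroup.

(** * Coset representatives and injectivity on the base group *)

Lemma right_transversal (G : groupType) (D : set G) : subgroup_set D ->
  exists (A : Type) (a : A -> G) (c : G -> A),
    [/\ forall g, D (g * (a (c g))^-1),
        forall d g, D d -> c (d * g) = c g &
        forall x, c (a x) = x].
Proof.
move=> [D1 DM DV]; pose rep u := xget 1 [set v | D (v * u^-1)].
have Drep u : D (rep u * u^-1).
  have : [set v | D (v * u^-1)] u by rewrite /= mulgV.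
  by move=> /(xgetI 1).
have repM d u : D d -> rep (d * u) = rep u.
  move=> Dd; congr xget; apply/seteqP; split=> v /= Dv.
  - by have := DM _ _ Dv Dd; rewrite invgM mulgA mulgVK.
  - by have := DM _ _ Dv (DV _ Dd); rewrite invgM mulgA.
have repK u : rep (rep u) == rep u.
  by have := repM _ u (Drep u); rewrite mulgVK => ->.
(* The transversal consists of the fixed points of [rep]. *)
exists {u | rep u == u}, val, (fun u => exist _ (rep u) (repK u)); split.
- by move=> g /=; have := DV _ (Drep g); rewrite invgF.
- by move=> d g Dd; apply/val_inj; exact: repM.
- by move=> x; apply/val_inj/eqP; exact: (valP x).
Qed.

Section BaseEmbedding.
Variables (U : topGroupType) (phi : openMono U).

Lemma om_range_subgroup : subgroup_set (phi @` om_dom phi).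
Proof.
have [O1 OM OV] := om_dom_subgroup phi.
split; first by exists 1; rewrite ?om_fun1.
- move=> _ _ [v Ov <-] [w Ow <-]; exists (v * w); first exact: OM.
  by apply: om_morph; rewrite inE.
- move=> _ [v Ov <-]; exists v^-1; first exact: OV.
  apply: (mulgI (phi v)); rewrite mulgV -om_morph ?inE //; last exact: OV.
  by rewrite mulgV om_fun1.
Qed.

Definition scons (T : Type) (x : T) (s : nat -> T) : nat -> T :=
  fun n => if n is m.+1 then s m else x.

Lemma scons_eta (T : Type) (s : nat -> T) : scons (s 0) (fun n => s n.+1) = s.
Proof. by apply/funext; case. Qed.

(** The two sequences serve as stacks that make [T] invertible even if [O] and [phi O] have
    different indices: [T] pushes the class of [g] on the first and pops a class for the new element
    from the second. *)
Lemma free_conjugating_bijection : exists (S : Type) (f : U -> bijection S)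
    (T : bijection S),
  [/\ group_hom f, injective f &
      forall w, om_dom phi w -> T * f w * T^-1 = f (phi w)].
Proof.
have Os := om_dom_subgroup phi; have [O1 OM OV] := Os.
have [A [a [c [ac cM cK]]]] := right_transversal Os.
have [B [b [e [be eM eK]]]] := right_transversal om_range_subgroup.
(* [psi] inverts [phi] on its image; the value [1] elsewhere is arbitrary. *)
have /choice[psi psiP] (p : U) : exists w, (phi @` om_dom phi) p ->
    om_dom phi w /\ phi w = p.
  have [[w Ow <-]|np] := pselect ((phi @` om_dom phi) p); first by exists w.
  by exists 1 => /np.
have phiK w : om_dom phi w -> psi (phi w) = w.
  move=> Ow; have [|Op pE] := psiP (phi w); first by exists w.
  by apply: (@om_inj U phi) => //; rewrite inE.
pose S := (U * (nat -> A) * (nat -> B))%type.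
pose L u (s : S) : S := (u * s.1.1, s.1.2, s.2).
pose T (s : S) : S := (phi (s.1.1 * (a (c s.1.1))^-1) * b (s.2 0),
  scons (c s.1.1) s.1.2, fun n => s.2 n.+1).
pose T' (s : S) : S := (psi (s.1.1 * (b (e s.1.1))^-1) * a (s.1.2 0),
  fun n => s.1.2 n.+1, scons (e s.1.1) s.2).
have LK u : cancel (L u) (L u^-1).
  by move=> [[g al] bt]; rewrite /L /= mulKg.
have LVK u : cancel (L u^-1) (L u).
  by move=> [[g al] bt]; rewrite /L /= mulVKg.
have TK : cancel T T'.
  move=> [[g al] bt]; rewrite /T /T' /=.
  have Op : (phi @` om_dom phi) (phi (g * (a (c g))^-1)) by eexists.
  (* The left factor from [phi O] does not change the coset, so [e] recovers the popped class. *)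
  by rewrite eM // eK mulgK phiK // mulgVK scons_eta.
have T'K : cancel T' T.
  move=> [[g al] bt]; rewrite /T /T' /=.
  have [Op pE] := psiP _ (be g).
  by rewrite cM // cK mulgK pE mulgVK scons_eta.
exists S, (fun u => Bijection (LK u) (LVK u)), (Bijection TK T'K); split.
- move=> u v; apply: bijection_ext => -[[g al] bt].
  by rewrite bij_mulE /= /L /= mulgA.
(* Evaluation at a point with first coordinate [1] recovers [u]; [c 1] and [e 1] merely supply
   elements of [A] and [B]. *)
- move=> u v /(congr1 (fun f : bijection S =>
    (f (1, fun=> c 1, fun=> e 1)).1.1)).
  by rewrite /= !mulg1.
- move=> w Ow; apply/eqP; rewrite divg_eq; apply/eqP.
  apply: bijection_ext => -[[g al] bt].
  rewrite !bij_mulE /= /L /T /= cM // -mulgA.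
  by rewrite (@om_morph U phi w) ?inE // mulgA.
Qed.

(** All stable letters may act by the same bijection [T], and [U] already acts faithfully. *)
Lemma hnn_U_inj (X : finType) : injective (hnn_U phi X).
Proof.
have [S [f [T [fM f_inj Tf]]]] := free_conjugating_bijection.
have [F [_ FU _]] := hnn_lift (X := X) (t := fun=> T) fM (fun=> Tf).
by move=> u v uv; apply: f_inj; rewrite -!FU uv.
Qed.

End BaseEmbedding.

(** * Open homomorphisms, separation and continuity *)

Section OpenHom.
Variables (G H : topGroupType) (f : G -> H).
Hypotheses (fM : group_hom f) (f_open : open_map f).

Lemma open_map_translate (h : H) : open_map (fun x => h * f x).
Proof.
move=> V oV; rewrite (_ : _ @` V = [set y | (f @` V) (h^-1 * y)]).
  have /continuousP := @lmulg_continuous H h^-1.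
  by apply; exact: f_open.
apply/seteqP; split=> y /= [v Vv].
- by move=> <-; exists v => //; rewrite mulKg.
- by move=> e; exists v => //; rewrite e mulVKg.
Qed.

Lemma nbhs_open_translate (h : H) (x : G) (V : set G) :
  nbhs x V -> nbhs (h * f x) [set h * f v | v in V].
Proof.
rewrite nbhsE => -[B [oB Bx] BV].
apply: (@filterS _ _ _ [set h * f v | v in B]); first exact: image_subset.
by apply: open_nbhs_nbhs; split; [exact: open_map_translate|exists x].
Qed.

Lemma open_subgroup_hausdorff : injective f ->
  hausdorff_space G -> hausdorff_space H.
Proof.
move=> f_inj G_hausdorff p q pq.
(* Cosets of the image of [f] are neighbourhoods of their points, so the inseparable [p] and [q]
   share one. *)
have nT r : nbhs r [set r * f v | v in setT].
  rewrite -{1}(mulg1 r) -(group_hom1 fM).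
  by apply: nbhs_open_translate; exact: filterT.
have [_ [[u _ <-] [v _ e]]] := pq _ _ (nT p) (nT q).
have qE : q = p * f (u * v^-1).
  by rewrite fM (group_homV fM) mulgA -e mulgK.
suff uv : 1 = u * v^-1 by rewrite qE -uv (group_hom1 fM) mulg1.
(* Translation by [p] carries these to neighbourhoods of [p] and [q], which meet; injectivity of [f]
   brings the common point back to [G]. *)
apply: G_hausdorff => A B nA nB.
have nA' := @nbhs_open_translate p _ _ nA.
have nB' := @nbhs_open_translate p _ _ nB.
rewrite (group_hom1 fM) mulg1 in nA'; rewrite -qE in nB'.
have [_ [[y Ay <-] [z Bz /mulgI/f_inj zy]]] := pq _ _ nA' nB'.
by exists y; split=> //; rewrite -zy.
Qed.

End OpenHom.

Section HnnHom.
Variables (U : topGroupType) (phi : openMono U) (X : finType) (H : topGroupType).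
Variable f : hnn phi X -> H.
Hypothesis fM : group_hom f.

(** Neighbourhoods of [h] are detected on the translate of the base group by [h], so continuity at
    [1] in [U] suffices. *)
Lemma hnn_hom_continuous : continuous (f \o hnn_U phi X) -> continuous f.
Proof.
move=> fc h W nW; apply/(@hnn_nbhsP U phi X h (f @^-1` W)).
have nW1 : nbhs (f (hnn_U phi X 1)) [set y | W (f h * y)].
  by apply: lmulg_continuous; rewrite hnn_U1 (group_hom1 fM) mulg1.
have : nbhs (1 : U) [set u | W (f h * f (hnn_U phi X u))] := fc 1 _ nW1.
by apply: filterS => u /=; rewrite fM.
Qed.

Lemma hnn_hom_open : open_map (f \o hnn_U phi X) -> open_map f.
Proof.
move=> fo W oW; rewrite openE => _ [h Wh <-].
have /hnn_nbhsP nW : nbhs h W by exact: open_nbhs_nbhs.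
have := nbhs_open_translate fo (f h) nW.
rewrite /= hnn_U1 (group_hom1 fM) mulg1.
by apply: filterS => _ [u Wu <-]; exists (h * hnn_U phi X u).
Qed.

End HnnHom.

(** Near a point [p] adherent to [K] there are points fixed by [r], so [r p] and [p] cannot be
    separated. *)
Lemma closed_retract (T : topologicalType) (r : T -> T) (K : set T) :
  hausdorff_space T -> continuous r -> (forall x, K (r x)) ->
  (forall x, K x -> r x = x) -> closed K.
Proof.
move=> T_hausdorff rc rK Kr p clp; rewrite -(T_hausdorff (r p) p) //.
move=> A B nA nB; have nrA : nbhs p (r @^-1` A) := rc p A nA.
have [x [Kx [Ax Bx]]] := clp _ (filterI nrA nB).
by exists x; split=> //; rewrite -(Kr x Kx).
Qed.

(** * The epimorphism, its sections and the retracts *)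

Theorem theorem3p15 (X : finType) (X_nonempty : (0 < #|X|)%N)
    (R : set (free_group X)) (R_balanced : balanced R)
    (U : topGroupType) (U_hausdorff : hausdorff_space U) (phi : openMono U) :
  (* H_{t}(phi) is [hnn phi unit], with stable letter [hnn_t phi tt] *)
  exists psi : gen_group phi R -> hnn phi unit,
    [/\ (* (1) *)
        [/\ cont_epi psi,
            forall u : U, psi (gen_U phi R u) = hnn_U phi unit u &
            forall x : X, psi (gen_X phi R x) = hnn_t phi tt],
        (* (2) *)
        can_be_generalised phi R &
        (* (3) and (4) *)
        forall x : X, exists j : hnn phi unit -> gen_group phi R,
          [/\ cont_open_mono j,
              cancel j psi,
              forall u : U, j (hnn_U phi unit u) = gen_U phi R u,
              j (hnn_t phi tt) = gen_X phi R x &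
              top_isomorphic_subgroup (hnn phi unit) (range j) /\
              group_retract (range j)]].
Proof.
(* [P] is the future composite of [psi] with the projection: it identifies all stable letters. *)
have [P [PM PU Pt]] := hnn_lift (X := X) (@hnn_UM U phi unit)
  (fun=> hnn_t_conj tt).
have PF : group_hom (P \o hnn_F phi (X := X)) by move=> g h; rewrite /= hnn_FM PM.
have [psi [psiM psiE]] : exists psi : gen_group phi R -> hnn phi unit,
    group_hom psi /\ forall h, psi (gen_proj R h) = P h.
  apply: (quot_lift PM).
  by move=> _ [r Rr <-]; exact: (balanced_ker PF Pt) (R_balanced r Rr).
have psiU u : psi (gen_U phi R u) = hnn_U phi unit u by rewrite psiE.
have psiX x : psi (gen_X phi R x) = hnn_t phi tt by rewrite psiE.
have Pc : continuous P.
  apply: hnn_hom_continuous => //; rewrite (_ : P \o _ = hnn_U phi unit).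
    exact: hnn_U_continuous.
  exact/funext.
have psic : continuous psi.
  apply/continuousP => W oW; rewrite gen_openE.
  have /continuousP/(_ _ oW) := Pc.
  by congr (open _); apply/seteqP; split=> h /=; rewrite psiE.
have genU_inj : injective (gen_U phi R).
  by move=> u v /(congr1 psi); rewrite !psiU; exact: hnn_U_inj.
have genUM : group_hom (gen_U phi R).
  by move=> u v; rewrite /gen_U hnn_UM gen_projM.
have genUc : continuous (gen_U phi R).
  move=> u; apply: continuous_comp; first exact: hnn_U_continuous.
  exact: gen_proj_continuous.
have genUo : open_map (gen_U phi R).
  move=> V oV; rewrite (_ : _ @` V = gen_proj R @` (hnn_U phi X @` V)).
    exact/gen_proj_open/hnn_U_open.
  by rewrite image_comp.
have secP (x : X) : exists j : hnn phi unit -> gen_group phi R,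
    [/\ cont_open_mono j, cancel j psi,
        forall u, j (hnn_U phi unit u) = gen_U phi R u &
        j (hnn_t phi tt) = gen_X phi R x].
  have [|j [jM jU /(_ tt) jt]] :=
      @hnn_lift U phi unit _ _ (fun=> gen_X phi R x) genUM.
    move=> _ w Ow; rewrite /gen_X /gen_U -gen_projV -!gen_projM.
    by rewrite hnn_t_conj.
  have jK : cancel j psi.
    (* Both sides are multiplicative, so generators suffice. *)
    apply: hnn_ind => [|g h gK hK|u|[]|[]].
    - by rewrite !group_hom1.
    - by rewrite jM psiM gK hK.
    - by rewrite jU psiU.
    - by rewrite jt psiX.
    - by rewrite !group_homV // jt psiX.
  have jUE : j \o hnn_U phi unit = gen_U phi R by exact/funext.
  exists j; split=> //; split=> //; first exact: can_inj jK.
  - by apply: hnn_hom_continuous => //; rewrite jUE.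
  - by apply: hnn_hom_open => //; rewrite jUE.
exists psi; split=> //.
  split=> //; split=> // h _.
  (* Surjectivity follows from the section at any single [x]. *)
  have /card_gt0P[x _] := X_nonempty.
  by have [j [_ jK _ _]] := secP x; exists (j h).
move=> x; have [j [jmono jK jU jt]] := secP x; exists j; split=> //.
have [jM j_inj jc jo] := jmono.
split.
  exists j, psi; split=> //; last exact: continuous_subspaceT.
  by split=> [h _|h k _ _ /j_inj|] //; exists h.
have Hd := open_subgroup_hausdorff genUM genUo genU_inj U_hausdorff.
(* The retraction onto the range of [j] is [j \o psi]. *)
have rc : continuous (j \o psi).
  by move=> g; apply: continuous_comp; [exact: psic|exact: jc].
have rK g : range j ((j \o psi) g) by exists (psi g).
have Kr g : range j g -> (j \o psi) g = g by move=> [h _ <-] /=; rewrite jK.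
split=> //.
- split; first by exists 1 => //; exact: group_hom1.
  + by move=> _ _ [g _ <-] [h _ <-]; exists (g * h).
  + by move=> _ [g _ <-]; exists g^-1 => //; exact: group_homV.
- exact: closed_retract Hd rc rK Kr.
- exists (j \o psi); split=> //.
  + by move=> g h; rewrite /= psiM jM.
  + by move=> _ [h _ <-]; exists (j h) => //=; rewrite jK.
Qed.
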